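(* For every pure quaternion $c$ in the spherical Mandelbrot set $\mathcal{M}_{\mathrm{Im}\mathbb{H}}$, we have $\|c\|\le 2$.
   Context: $\mathrm{Im}\,\mathbb{H}=\{ai+bj+ck : a,b,c\in\mathbb{R}\}$ is the set of pure quaternions, with Euclidean norm $\|ai+bj+ck\|=\sqrt{a^2+b^2+c^2}$. Unique spherical representation: every $q\in\mathrm{Im}\,\mathbb{H}$ is written $q=\rho(i\sin\phi\cos\theta+j\sin\phi\sin\theta+k\cos\phi)$ with $\rho=\|q\|\ge 0$, $0\le\theta<2\pi$, $0\le\phi\le\pi$; the triple $(\rho,\theta,\phi)$ is made unique by the conventions: for $q=0$ take $\theta=\phi=0$; for $q=ck$ with $c>0$ take $(c,0,0)$; for $q=ck$ with $c<0$ take $(|c|,0,\pi)$. Spherical power: $sp_n(q):=\rho^n\left(i\sin(n\phi)\cos(n\theta)+j\sin(n\phi)\sin(n\theta)+k\cos(n\phi)\right)$, where $(\rho,\theta,\phi)$ is the unique spherical representation of $q$. For $c\in\mathrm{Im}\,\mathbb{H}$ let $Q_c(q)=sp_2(q)+c$ for $q\in\mathrm{Im}\,\mathbb{H}$, and let $Q_c^{(n)}$ be its $n$-fold composition. The spherical Mandelbrot set is $\mathcal{M}_{\mathrm{Im}\mathbb{H}}:=\{c\in\mathrm{Im}\,\mathbb{H} : \{Q_c^{(n)}(0)\}_{n\in\mathbb{N}}\text{ is bounded}\}$. *)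

(* Defs.v *)
From mathcomp Require Import all_boot all_order all_algebra.
From mathcomp Require Import all_classical all_reals all_analysis.
From mathcomp Require Import ring lra.

Set Implicit Arguments.
Unset Strict Implicit.
Unset Printing Implicit Defensive.

Import Order.TTheory GRing.Theory Num.Theory.

Local Open Scope classical_set_scope.
Local Open Scope ring_scope.

(* Pure quaternions, as coordinate vectors (a, b, c) standing for ai + bj + ck.
   The quaternion product plays no role in what follows. *)
Notation imH R := 'rV[R]_3.

Definition qi {R : realType} : imH R := delta_mx 0 0.
Definition qj {R : realType} : imH R := delta_mx 0 1.
Definition qk {R : realType} : imH R := delta_mx 0 2.

(* The canonical norm of row vectors is the sup norm, so the Euclidean norm is
   defined separately. *)
Definition qnorm {R : realType} (q : imH R) : R :=
  Num.sqrt (q 0 0 ^+ 2 + q 0 1 ^+ 2 + q 0 2 ^+ 2).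

Definition spherical {R : realType} (rho theta phi : R) : imH R :=
  rho *: ((sin phi * cos theta) *: qi + (sin phi * sin theta) *: qj
          + cos phi *: qk).

Definition is_spherical_rep {R : realType} (q : imH R)
    (rho theta phi : R) : Prop :=
  [/\ rho = qnorm q /\ q = spherical rho theta phi,
      0 <= theta < 2 * pi,
      0 <= phi <= pi,
      q = 0 -> theta = 0 /\ phi = 0 &
      forall c : R, q = c *: qk ->
        (0 < c -> (rho, theta, phi) = (c, 0, 0)) /\
        (c < 0 -> (rho, theta, phi) = (`|c|, 0, pi))].

(* The triple (rho, theta, phi); spherical_rep_exists and spherical_rep_unique
   below show that exactly one triple qualifies, so the default is unused. *)
Definition spherical_rep {R : realType} (q : imH R) : R * R * R :=
  xget (0, 0, 0) [set t : R * R * R | is_spherical_rep q t.1.1 t.1.2 t.2].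

Definition sp {R : realType} (n : nat) (q : imH R) : imH R :=
  let: (rho, theta, phi) := spherical_rep q in
  spherical (rho ^+ n) (n%:R * theta) (n%:R * phi).

Definition Qmap {R : realType} (c q : imH R) : imH R := sp 2 q + c.

Definition spherical_mandelbrot {R : realType} : set (imH R) :=
  [set c | exists M : R, forall n : nat, qnorm (iter n (Qmap c) 0) <= M].

Section SphericalRep.
Variable R : realType.
Implicit Types (q : imH R) (a b c r s t u v : R).

Lemma qcoordE a b c :
  let q : imH R := a *: qi + b *: qj + c *: qk in
  [/\ q 0 0 = a, q 0 1 = b & q 0 2 = c].
Proof. by split; rewrite !mxE /=; ring. Qed.

Lemma qspan q : q = q 0 0 *: qi + q 0 1 *: qj + q 0 2 *: qk.
Proof.
have [h0 h1 h2] := qcoordE (q 0 0) (q 0 1) (q 0 2).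
apply/rowP => -[[|[|[|//]]] lt_i].
- by rewrite (_ : Ordinal _ = 0) ?h0 //; apply/val_inj.
- by rewrite (_ : Ordinal _ = 1) ?h1 //; apply/val_inj.
- by rewrite (_ : Ordinal _ = 2) ?h2 //; apply/val_inj.
Qed.

Lemma qcoordP q q' :
  [/\ q 0 0 = q' 0 0, q 0 1 = q' 0 1 & q 0 2 = q' 0 2] -> q = q'.
Proof. by case=> h0 h1 h2; rewrite (qspan q) (qspan q') h0 h1 h2. Qed.

Lemma sphericalE r t u :
  [/\ spherical r t u 0 0 = r * (sin u * cos t),
      spherical r t u 0 1 = r * (sin u * sin t) &
      spherical r t u 0 2 = r * cos u].
Proof. by split; rewrite !mxE /=; ring. Qed.

Lemma qkE c : [/\ (c *: qk : imH R) 0 0 = 0, (c *: qk : imH R) 0 1 = 0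
  & (c *: qk : imH R) 0 2 = c].
Proof. by split; rewrite !mxE /=; ring. Qed.

Lemma q0E : [/\ (0 : imH R) 0 0 = 0, (0 : imH R) 0 1 = 0
  & (0 : imH R) 0 2 = 0].
Proof. by split; rewrite mxE. Qed.

Lemma sin_lt0_pi2pi t : pi < t < 2 * pi -> sin t < 0.
Proof.
move=> /andP[t1 t2]; rewrite -(subrK pi t) sinDpi oppr_lt0.
by apply: sin_gt0_pi; apply/andP; split; lra.
Qed.

Lemma angle_inj s t : 0 <= s < 2 * pi -> 0 <= t < 2 * pi ->
  cos s = cos t -> sin s = sin t -> s = t.
Proof.
have cos2piB u : cos (2 * pi - u) = cos u.
  by rewrite -cosN opprB -(cosD2pi (u - 2 * pi)); congr cos; ring.
move=> /andP[s0 s2] /andP[t0 t2] ec es.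
have [sp|sp] := leP s pi; have [tp|tp] := leP t pi.
- by apply: cos_inj; rewrite ?in_itv/= ?s0 ?t0.
- have := @sin_ge0_pi R s; rewrite s0 sp es => /(_ isT).
  by rewrite leNgt sin_lt0_pi2pi// tp.
- have := @sin_ge0_pi R t; rewrite t0 tp -es => /(_ isT).
  by rewrite leNgt sin_lt0_pi2pi// sp.
- suff : 2 * pi - s = 2 * pi - t by move=> h; lra.
  apply: cos_inj; rewrite ?cos2piB// in_itv/=; apply/andP; split; lra.
Qed.

Lemma angle_ex a b : a ^+ 2 + b ^+ 2 = 1 ->
  exists2 t : R, 0 <= t < 2 * pi & cos t = a /\ sin t = b.
Proof.
move=> ab; have pi0 := pi_gt0 R.
have aB : -1 <= a <= 1 by apply/andP; split; nra.
have ac : cos (acos a) = a by rewrite acosK.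
have as_ : sin (acos a) = `|b|.
  by rewrite sin_acos// -ab addrAC subrr add0r sqrtr_sqr.
have a0 := acos_ge0 aB; have api := acos_lepi aB.
have [b0|b0] := leP 0 b.
  exists (acos a); first by apply/andP; split; lra.
  by rewrite ac as_ ger0_norm.
exists (2 * pi - acos a).
  apply/andP; split; first lra.
  rewrite gtrBl lt_neqAle a0 andbT; apply/eqP => h.
  by move: as_; rewrite -h sin0 ltr0_norm// => ?; lra.
have e : 2 * pi - acos a = - acos a + pi *+ 2 by ring.
by rewrite e cosD2pi sinD2pi cosN sinN ac as_ ltr0_norm// opprK.
Qed.

Lemma qnorm_eq0 q : qnorm q = 0 -> q = 0.
Proof.
move=> /eqP; rewrite sqrtr_eq0 => h; have [z0 z1 z2] := q0E.
by apply/qcoordP; rewrite z0 z1 z2; split; nra.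
Qed.

Lemma spherical_rep_exists q : exists t : R * R * R,
  is_spherical_rep q t.1.1 t.1.2 t.2.
Proof.
have pi0 := pi_gt0 R; have [z0 z1 z2] := q0E.
have [/eqP|ab] := eqVneq (q 0 0 ^+ 2 + q 0 1 ^+ 2) 0.
  rewrite paddr_eq0 ?sqr_ge0// !sqrf_eq0 => /andP[/eqP a0 /eqP b0].
  have nq : qnorm q = `|q 0 2|.
    by rewrite /qnorm a0 b0 expr0n/= !add0r sqrtr_sqr.
  have [c0|c0] := leP 0 (q 0 2).
    exists (q 0 2, 0, 0) => /=.
    have [s0 s1 s2] := sphericalE (q 0 2) 0 0.
    split; rewrite ?lexx//; try (by apply/andP; split; lra).
      split; first by rewrite nq ger0_norm.
      by apply/qcoordP; rewrite s0 s1 s2 a0 b0 sin0 cos0; split; ring.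
    move=> c e; have [_ _ k2] := qkE c.
    move: c0; rewrite e k2 => c0; split=> [//|cn].
    by move: c0; rewrite leNgt cn.
  exists (- q 0 2, 0, pi) => /=.
  have [s0 s1 s2] := sphericalE (- q 0 2) 0 pi.
  split; rewrite ?lexx//; try (by apply/andP; split; lra).
  - split; first by rewrite nq ltr0_norm.
    by apply/qcoordP; rewrite s0 s1 s2 a0 b0 sinpi cospi; split; ring.
  - by move=> e; move: c0; rewrite e z2 ltxx.
  - move=> c e; have [_ _ k2] := qkE c.
    move: c0; rewrite e k2 => c0; split=> [cp|_].
      by move: (lt_trans cp c0); rewrite ltxx.
    by rewrite ltr0_norm.
have p0 : 0 < q 0 0 ^+ 2 + q 0 1 ^+ 2.
  by rewrite lt_neqAle eq_sym ab addr_ge0 ?sqr_ge0.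
set p := Num.sqrt (q 0 0 ^+ 2 + q 0 1 ^+ 2).
have pg : 0 < p by rewrite sqrtr_gt0.
have p2 : p ^+ 2 = q 0 0 ^+ 2 + q 0 1 ^+ 2 by rewrite sqr_sqrtr// ltW.
have n0 : 0 < qnorm q.
  by rewrite sqrtr_gt0 ltr_wpDr ?sqr_ge0.
have n2 : qnorm q ^+ 2 = q 0 0 ^+ 2 + q 0 1 ^+ 2 + q 0 2 ^+ 2.
  by rewrite sqr_sqrtr// ?addr_ge0 ?sqr_ge0.
have [|t tB [ct st]] := @angle_ex (q 0 0 / p) (q 0 1 / p).
  by rewrite !expr_div_n -mulrDl -p2 divff// expf_neq0// gt_eqF.
have cB : -1 <= q 0 2 / qnorm q <= 1.
  rewrite ler_pdivlMr// ler_pdivrMr//; apply/andP; split; nra.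
have cphi : cos (acos (q 0 2 / qnorm q)) = q 0 2 / qnorm q by rewrite acosK.
have sphi : sin (acos (q 0 2 / qnorm q)) = p / qnorm q.
  rewrite sin_acos//; have -> : 1 - (q 0 2 / qnorm q) ^+ 2 = (p / qnorm q) ^+ 2.
    rewrite !expr_div_n p2.
    have -> : q 0 0 ^+ 2 + q 0 1 ^+ 2 = qnorm q ^+ 2 - q 0 2 ^+ 2.
      by rewrite n2; ring.
    by field; rewrite gt_eqF.
  by rewrite sqrtr_sqr ger0_norm// divr_ge0// ltW.
exists (qnorm q, t, acos (q 0 2 / qnorm q)) => /=.
have [s0 s1 s2] := sphericalE (qnorm q) t (acos (q 0 2 / qnorm q)).
split => //.
- split=> //; apply/qcoordP; rewrite s0 s1 s2 cphi sphi ct st.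
  by split; field; rewrite ?gt_eqF.
- by rewrite acos_ge0// acos_lepi.
- by move=> e; move: p0; rewrite e z0 z1 expr0n/= addr0 ltxx.
- by move=> c e; have [k0 k1 _] := qkE c;
    move: p0; rewrite e k0 k1 expr0n/= addr0 ltxx.
Qed.

Lemma spherical_rep_unique q r t u r' t' u' :
  is_spherical_rep q r t u -> is_spherical_rep q r' t' u' ->
  (r, t, u) = (r', t', u').
Proof.
move=> [[-> e] tB uB h0 hk] [[-> e'] tB' uB' h0' hk'].
have [s0 s1 s2] := sphericalE (qnorm q) t u.
have [s0' s1' s2'] := sphericalE (qnorm q) t' u'.
have E0 : q 0 0 = qnorm q * (sin u * cos t) by rewrite {1}e.
have E1 : q 0 1 = qnorm q * (sin u * sin t) by rewrite {1}e.
have E2 : q 0 2 = qnorm q * cos u by rewrite {1}e.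
have E0' : q 0 0 = qnorm q * (sin u' * cos t') by rewrite {1}e'.
have E1' : q 0 1 = qnorm q * (sin u' * sin t') by rewrite {1}e'.
have E2' : q 0 2 = qnorm q * cos u' by rewrite {1}e'.
have [/qnorm_eq0 q0|n0] := eqVneq (qnorm q) 0.
  by have [-> ->] := h0 q0; have [-> ->] := h0' q0.
have eu : u = u'.
  apply: cos_inj; rewrite ?in_itv//.
  by apply: (mulfI n0); rewrite -E2 -E2'.
subst u'.
have [su|su] := eqVneq (sin u) 0.
  have ek : q = q 0 2 *: qk.
    by rewrite {1}(qspan q) E0 E1 su !mul0r mulr0 !scale0r !add0r.
  have [hp hn] := hk _ ek; have [hp' hn'] := hk' _ ek.
  have [c0|c0|c0] := ltrgtP (q 0 2) 0.
  - by rewrite hn// hn'.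
  - by rewrite hp// hp'.
  - have q0 : q = 0 by rewrite ek c0 scale0r.
    by have [-> _] := h0 q0; have [-> _] := h0' q0.
suff -> : t = t' by [].
apply: angle_inj => //.
- by apply: (mulfI su); apply: (mulfI n0); rewrite -E0 -E0'.
- by apply: (mulfI su); apply: (mulfI n0); rewrite -E1 -E1'.
Qed.

Lemma spherical_repP q :
  let: (rho, theta, phi) := spherical_rep q in is_spherical_rep q rho theta phi.
Proof.
have := xgetPex (0, 0, 0) (spherical_rep_exists q); rewrite -/(spherical_rep q).
by case: (spherical_rep q) => [[]].
Qed.

End SphericalRep.

(* Main.v *)
(* The spherical power satisfies |sp_n q| = |q|^n, so |Q_c(q)| >= |q|^2 - |c|.
   If r = |c| > 2, then x^2 - r >= x + (r - 2) for every x >= r, because the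
   difference is at least (x - 1)(x - 2). Hence each step of the orbit after
   Q_c(0) = c adds at least r - 2 > 0 to the norm, and the orbit is unbounded. *)
Require Import Defs.
From mathcomp Require Import all_boot all_order all_algebra.
From mathcomp Require Import all_classical all_reals all_analysis.
From mathcomp Require Import ring lra.
Import Order.TTheory GRing.Theory Num.Theory.
Local Open Scope classical_set_scope.
Local Open Scope ring_scope.

Lemma qnorm_ge0 (R : realType) (q : imH R) : 0 <= qnorm q.
Proof. exact: sqrtr_ge0. Qed.

Lemma sqr_qnorm (R : realType) (q : imH R) :
  qnorm q ^+ 2 = q 0 0 ^+ 2 + q 0 1 ^+ 2 + q 0 2 ^+ 2.
Proof. by rewrite sqr_sqrtr// !addr_ge0// sqr_ge0. Qed.

Lemma qnorm0 (R : realType) : qnorm (0 : imH R) = 0.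
Proof. by rewrite /qnorm !mxE expr0n/= !addr0 sqrtr0. Qed.

(** After squaring, Lagrange's identity writes the gap between the two sides as the sum of squares
    of the 2x2 minors of [p] and [q]. *)
Lemma qnorm_cauchy_schwarz (R : realType) (p q : imH R) :
  `|p 0 0 * q 0 0 + p 0 1 * q 0 1 + p 0 2 * q 0 2| <= qnorm p * qnorm q.
Proof.
rewrite -ler_sqr ?nnegrE ?mulr_ge0 ?qnorm_ge0// real_normK ?num_real//.
rewrite exprMn !sqr_qnorm -subr_ge0.
set a := p 0 0; set b := p 0 1; set c := p 0 2.
set x := q 0 0; set y := q 0 1; set z := q 0 2.
have -> : (a ^+ 2 + b ^+ 2 + c ^+ 2) * (x ^+ 2 + y ^+ 2 + z ^+ 2)
    - (a * x + b * y + c * z) ^+ 2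
  = (a * y - b * x) ^+ 2 + (a * z - c * x) ^+ 2 + (b * z - c * y) ^+ 2.
  by ring.
by rewrite !addr_ge0// sqr_ge0.
Qed.

Lemma lerB_qnormD (R : realType) (p q : imH R) :
  qnorm p - qnorm q <= qnorm (p + q).
Proof.
(* The difference may be negative; its absolute value can be squared safely. *)
apply: le_trans (ler_norm _) _.
rewrite -ler_sqr ?nnegrE ?qnorm_ge0// real_normK ?num_real//.
have := qnorm_cauchy_schwarz R p q; rewrite ler_norml => /andP[pq _].
rewrite [leRHS]sqr_qnorm !mxE sqrrB !sqr_qnorm; lra.
Qed.

Lemma qnorm_spherical (R : realType) (r t u : R) :
  0 <= r -> qnorm (spherical r t u) = r.
Proof.
move=> r0; rewrite /qnorm; have [-> -> ->] := sphericalE r t u.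
have -> : (r * (sin u * cos t)) ^+ 2 + (r * (sin u * sin t)) ^+ 2
    + (r * cos u) ^+ 2
  = r ^+ 2 * (cos u ^+ 2 + sin u ^+ 2 * (cos t ^+ 2 + sin t ^+ 2)) by ring.
by rewrite cos2Dsin2 mulr1 cos2Dsin2 mulr1 sqrtr_sqr ger0_norm.
Qed.

Lemma qnorm_sp (R : realType) (n : nat) (q : imH R) :
  qnorm (sp n q) = qnorm q ^+ n.
Proof.
rewrite /sp; have := spherical_repP q.
case: (spherical_rep q) => [[r t] u] [[-> _] _ _ _ _].
by rewrite qnorm_spherical// exprn_ge0// qnorm_ge0.
Qed.

(** [sp 2 0] vanishes because its norm does, so the angles chosen for 0 need not be computed. *)
Lemma Qmap0 (R : realType) (c : imH R) : Qmap c 0 = c.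
Proof.
by rewrite /Qmap (qnorm_eq0 (q := sp 2 0)) ?add0r// qnorm_sp qnorm0 expr0n.
Qed.

Lemma qnorm_Qmap_ge (R : realType) (c q : imH R) :
  qnorm q ^+ 2 - qnorm c <= qnorm (Qmap c q).
Proof. by rewrite -qnorm_sp lerB_qnormD. Qed.

(** The index is [n.+1] because growth starts from the first iterate, which is [c]. *)
Lemma qnorm_iter_Qmap_ge (R : realType) (c : imH R) (n : nat) :
  2 < qnorm c ->
  qnorm c + n%:R * (qnorm c - 2) <= qnorm (iter n.+1 (Qmap c) 0).
Proof.
move=> c2; elim: n => [|n IHn]; first by rewrite /= Qmap0 mul0r addr0.
rewrite iterS; apply: le_trans _ (qnorm_Qmap_ge R c _).
move: IHn; set x := qnorm (iter _ _ _) => IHn.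
(* The linear bound itself keeps the orbit outside the radius [qnorm c], where each step gains at
   least [qnorm c - 2]. *)
have cx : qnorm c <= x.
  by apply: le_trans IHn; rewrite lerDl mulr_ge0// subr_ge0 ltW.
have : 0 <= (x - 1) * (x - 2) by rewrite mulr_ge0//; lra.
rewrite -natr1; nra.
Qed.

Theorem theorem9 (R : realType) (c : imH R) :
  spherical_mandelbrot c -> qnorm c <= 2.
Proof.
move=> [M HM]; rewrite leNgt; apply/negP => c2.
have d0 : 0 < qnorm c - 2 by rewrite subr_gt0.
(* Archimedean choice of [n] with [n%:R * (qnorm c - 2)] above [|M|]; the absolute value makes the
   quotient nonnegative. *)
have /archi_boundP : 0 <= `|M| / (qnorm c - 2) by rewrite divr_ge0// ltW.
set n := Num.bound _; rewrite ltr_pdivrMr// => Mn.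
have := le_trans (qnorm_iter_Qmap_ge R c n c2) (HM n.+1).
by have := ler_norm M; lra.
Qed.
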